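(* Let $\Lambda$ be an arbitrary ring. The cotorsion functor $\mathfrak{q}$ on left $\Lambda$-modules is a coradical, i.e., $\mathfrak{q}(\mathfrak{q}^{-1}(C))=\{0\}$ for every left $\Lambda$-module $C$.
   Context: Let $\iota:\Lambda\to I$ be the injective envelope of $\Lambda$ viewed as a left $\Lambda$-module. For a left $\Lambda$-module $C$, the cotorsion module $\mathfrak{q}(C)$ of $C$ is the cokernel of the map $\mathrm{Hom}_\Lambda(I,C)\to\mathrm{Hom}_\Lambda(\Lambda,C)$ given by precomposition with $\iota$; equivalently, it is the quotient of $\mathrm{Hom}_\Lambda(\Lambda,C)$ by the subgroup of all maps $\Lambda\to C$ factoring through injective left modules. Via the canonical isomorphism $\mathrm{Hom}_\Lambda(\Lambda,C)\cong C$, $f\mapsto f(1)$, $\mathfrak{q}$ becomes a quotient functor of the identity functor on left $\Lambda$-modules. $\mathfrak{q}^{-1}(C)$ denotes the kernel of the canonical epimorphism $C\to\mathfrak{q}(C)$. *)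

(* Defs.v *)
From HB Require Import structures.
From mathcomp Require Import all_boot all_algebra all_classical.

Set Implicit Arguments.
Unset Strict Implicit.
Unset Printing Implicit Defensive.

Import GRing.Theory.
Local Open Scope ring_scope.
Local Open Scope quotient_scope.

(* [lmodType R] is MathComp's type of left modules over R, [R^o] is R as a left
   module over itself, and [pzRingType] allows the zero ring. *)

Definition HomMod (R : pzRingType) (M N : lmodType R) : Type := {linear M -> N}.

Section HomGroup.
Variables (R : pzRingType) (M N : lmodType R).
Implicit Types f g h : {linear M -> N}.

HB.instance Definition _ := gen_eqMixin (HomMod M N).
HB.instance Definition _ := gen_choiceMixin (HomMod M N).

Lemma hom_ext f g : f =1 g -> f = g.
Proof.
case: f g => [f cf] [g cg] /= /funext fg; case: _ / fg cg => cg.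
case: cf cg => [[a] [b]] [[a'] [b']].
by rewrite (Prop_irrelevance a a') (Prop_irrelevance b b').
Qed.

Definition hom_zero : HomMod M N := (\0 : {linear M -> N}).
Definition hom_opp (f : HomMod M N) : HomMod M N :=
  (\- (f : {linear M -> N}) : {linear M -> N}).
Definition hom_add (f g : HomMod M N) : HomMod M N :=
  ((f : {linear M -> N}) \+ (g : {linear M -> N}) : {linear M -> N}).

Fact hom_addA : associative hom_add.
Proof. by move=> f g h; apply: hom_ext => x /=; rewrite addrA. Qed.
Fact hom_addC : commutative hom_add.
Proof. by move=> f g; apply: hom_ext => x /=; rewrite addrC. Qed.
Fact hom_add0 : left_id hom_zero hom_add.
Proof. by move=> f; apply: hom_ext => x /=; rewrite add0r. Qed.
Fact hom_addN : left_inverse hom_zero hom_opp hom_add.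
Proof. by move=> f; apply: hom_ext => x /=; rewrite addNr. Qed.

HB.instance Definition _ :=
  GRing.isZmodule.Build (HomMod M N) hom_addA hom_addC hom_add0 hom_addN.

End HomGroup.

(* Hom_R(R, N) is a left R-module through right multiplication on R. *)
Section HomRegular.
Variables (R : pzRingType) (N : lmodType R).

Section Scale.
Variables (r : R) (f : {linear R^o -> N}).
Definition hom_scale_fun (a : R^o) : N := f ((a : R) * r).
Fact hom_scale_is_linear : linear hom_scale_fun.
Proof.
move=> k a b; rewrite /hom_scale_fun -linearP; congr (f _).
by rewrite mulrDl -mulrA.
Qed.
HB.instance Definition _ :=
  GRing.isLinear.Build R R^o N *:%R hom_scale_fun hom_scale_is_linear.
End Scale.

Definition hom_scale (r : R) (f : HomMod R^o N) : HomMod R^o N :=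
  (hom_scale_fun r f : {linear R^o -> N}).

Fact hom_scaleA r s f : hom_scale r (hom_scale s f) = hom_scale (r * s) f.
Proof.
by apply: hom_ext => a /=; rewrite /hom_scale_fun /= /hom_scale_fun mulrA.
Qed.
Fact hom_scale1 : left_id 1 hom_scale.
Proof. by move=> f; apply: hom_ext => a /=; rewrite /hom_scale_fun mulr1. Qed.
Fact hom_scaleDr : right_distributive hom_scale +%R.
Proof. by move=> r f g; apply: hom_ext => a. Qed.
Fact hom_scaleDl f : {morph hom_scale^~ f : r s / r + s}.
Proof.
move=> r s; apply: hom_ext => a /=.
by rewrite /hom_scale_fun mulrDr linearD.
Qed.

HB.instance Definition _ := GRing.Zmodule_isLmodule.Build R (HomMod R^o N)
  hom_scaleA hom_scale1 hom_scaleDr hom_scaleDl.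

Section OfElt.
Variable x : N.
Definition hom_of_elt_fun (a : R^o) : N := (a : R) *: x.
Fact hom_of_elt_fun_is_linear : linear hom_of_elt_fun.
Proof. by move=> k a b; rewrite /hom_of_elt_fun scalerDl scalerA. Qed.
HB.instance Definition _ :=
  GRing.isLinear.Build R R^o N *:%R hom_of_elt_fun hom_of_elt_fun_is_linear.
End OfElt.

(* The inverse N -> Hom_R(R, N) of the canonical isomorphism f |-> f 1. *)
Definition hom_of_elt (x : N) : HomMod R^o N :=
  (hom_of_elt_fun x : {linear R^o -> N}).

Fact hom_of_elt_is_linear : linear hom_of_elt.
Proof.
move=> k x y; apply: hom_ext => a /=.
by rewrite /hom_of_elt_fun /hom_scale_fun /= /hom_of_elt_fun scalerDr scalerA.
Qed.
HB.instance Definition _ :=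
  GRing.isLinear.Build R N (HomMod R^o N) *:%R hom_of_elt hom_of_elt_is_linear.

Lemma hom_of_eltK (x : N) : (hom_of_elt x : {linear R^o -> N}) 1 = x.
Proof. exact: scale1r. Qed.

Lemma hom_of_elt1 (f : {linear R^o -> N}) : hom_of_elt (f 1) = f.
Proof.
apply: hom_ext => a /=; rewrite /hom_of_elt_fun -linearZ; congr (f _).
exact: mulr1.
Qed.

End HomRegular.

Section Kernel.
Variables (R : pzRingType) (M N : lmodType R) (f : {linear M -> N}).

Definition ker_pred : {pred M} := [pred x | f x == 0].
Fact ker_pred_submod : subsemimod_closed ker_pred.
Proof.
apply: GRing.submod_closed_semi; split=> [|k x y]; rewrite !inE ?linear0 //.
by move=> /eqP fx /eqP fy; rewrite linearP fx fy scaler0 addr0.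
Qed.
HB.instance Definition _ := GRing.isSubmodClosed.Build R M ker_pred
  ker_pred_submod.

Lemma ker_predP x : reflect (f x = 0) (x \in ker_pred).
Proof. by rewrite inE; exact: eqP. Qed.

Record ker_mod := KerMod { ker_val : M; _ : ker_val \in ker_pred }.
HB.instance Definition _ := [isSub for ker_val].
HB.instance Definition _ := [Choice of ker_mod by <:].
HB.instance Definition _ := [SubChoice_isSubLmodule of ker_mod by <:].

End Kernel.

Section Cokernel.
Variables (A B : zmodType) (f : {additive A -> B}).

Definition image_pred : {pred B} := [pred y | `[< exists x : A, f x = y >]].
Fact image_pred_zmod : zmod_closed image_pred.
Proof.
split=> [|_ _ /asboolP[x <-] /asboolP[y <-]]; apply/asboolP.
  by exists 0; rewrite raddf0.
by exists (x - y); rewrite raddfB.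
Qed.
HB.instance Definition _ := GRing.isZmodClosed.Build B image_pred
  image_pred_zmod.

Definition coker := Quotient.quot (image_pred : zmodClosed B).
HB.instance Definition _ := GRing.Zmodule.on coker.

Definition coker_proj (y : B) : coker := \pi_(Quotient.quot image_pred) y.

End Cokernel.

Section InjectiveEnvelope.
Variable R : pzRingType.

Definition injective_module (I : lmodType R) : Prop :=
  forall (A B : lmodType R) (i : {linear A -> B}), injective i ->
  forall g : {linear A -> I}, exists h : {linear B -> I},
    forall a, h (i a) = g a.

Definition essential (M N : lmodType R) (i : {linear M -> N}) : Prop :=
  forall S : submodClosed N,
    (forall x, i x \in S -> i x = 0) -> forall y, y \in S -> y = 0.

Record injective_envelope (M : lmodType R) := InjectiveEnvelope {
  env_mod :> lmodType R;
  env_map : {linear M -> env_mod};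
  env_map_inj : injective env_map;
  env_injective : injective_module env_mod;
  env_essential : essential env_map
}.

End InjectiveEnvelope.

(* Quotient functors of the identity functor on left R-modules: a functor
   together with an objectwise surjective natural transformation from the
   identity. *)
Record quotient_functor (R : pzRingType) := QuotientFunctor {
  qf_obj :> lmodType R -> lmodType R;
  qf_map : forall M N : lmodType R,
    {linear M -> N} -> {linear qf_obj M -> qf_obj N};
  qf_proj : forall M : lmodType R, {linear M -> qf_obj M};
  qf_map_id : forall (M : lmodType R) (z : qf_obj M),
    qf_map (idfun : {linear M -> M}) z = z;
  qf_map_comp : forall (M N P : lmodType R)
      (g : {linear N -> P}) (f : {linear M -> N}) (z : qf_obj M),
    qf_map (g \o f : {linear M -> P}) z = qf_map g (qf_map f z);
  qf_proj_surj : forall (M : lmodType R) (z : qf_obj M),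
    exists x : M, qf_proj M x = z;
  qf_proj_natural : forall (M N : lmodType R) (f : {linear M -> N}) (x : M),
    qf_map f (qf_proj M x) = qf_proj N (f x)
}.

(* q^-1(C) *)
Definition qf_ker (R : pzRingType) (q : quotient_functor R) (C : lmodType R) :
  lmodType R := ker_mod (qf_proj q C).

Definition coradical (R : pzRingType) (q : quotient_functor R) : Prop :=
  forall (C : lmodType R) (z : q (qf_ker q C)), z = 0.

Section Cotorsion.
Variables (R : pzRingType) (E : injective_envelope R^o).

Let iota : {linear R^o -> E} := env_map E.

Section Object.
Variable C : lmodType R.

Definition precomp_iota (g : HomMod E C) : HomMod R^o C :=
  ((g : {linear E -> C}) \o iota : {linear R^o -> C}).
Fact precomp_iota_is_zmod_morphism : zmod_morphism precomp_iota.
Proof. by move=> g h; apply: hom_ext. Qed.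
HB.instance Definition _ := GRing.isZmodMorphism.Build
  (HomMod E C) (HomMod R^o C) precomp_iota precomp_iota_is_zmod_morphism.

Definition cotorsion_mod := coker precomp_iota.
HB.instance Definition _ := GRing.Zmodule.on cotorsion_mod.


Definition cotorsion_class (f : HomMod R^o C) : cotorsion_mod := coker_proj _ f.

Lemma cotorsion_classE f g :
  cotorsion_class f = cotorsion_class g <->
  exists h : HomMod E C, precomp_iota h = f - g.
Proof.
rewrite /cotorsion_class /coker_proj; split.
  by move/eqP; rewrite -Quotient.idealrBE => /asboolP.
by move=> ?; apply/eqP; rewrite -Quotient.idealrBE; apply/asboolP.
Qed.

Fact cotorsion_class_is_zmod_morphism : zmod_morphism cotorsion_class.
Proof. exact: raddfB (\pi_(Quotient.quot (image_pred precomp_iota))). Qed.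
HB.instance Definition _ := GRing.isZmodMorphism.Build
  (HomMod R^o C) cotorsion_mod cotorsion_class cotorsion_class_is_zmod_morphism.

Lemma cotorsion_class_surj z : exists f, cotorsion_class f = z.
Proof. by exists (repr (z : Quotient.quot _)); exact: reprK. Qed.

(* The cokernel is a priori only an abelian group; it is a left R-module because
   the image of Hom(I, C) in Hom(R, C) is a submodule, I being injective. *)
Lemma precomp_iota_scale r (h : HomMod E C) :
  exists h' : HomMod E C, precomp_iota h' = r *: precomp_iota h.
Proof.
have [k kE] := env_injective (env_map_inj (i := E))
  (hom_of_elt (r *: iota 1) : {linear R^o -> E}).
exists ((h : {linear E -> C}) \o k : {linear E -> C}).
apply: hom_ext => a /=; rewrite kE /= /hom_of_elt_fun /hom_scale_fun /=.
by rewrite scalerA -linearZ; congr (h (iota _)); exact: mulr1.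
Qed.

Definition cotorsion_scale (r : R) (z : cotorsion_mod) : cotorsion_mod :=
  cotorsion_class (r *: repr (z : Quotient.quot _)).

Lemma cotorsion_scaleE r f :
  cotorsion_scale r (cotorsion_class f) = cotorsion_class (r *: f).
Proof.
apply/cotorsion_classE; rewrite -scalerBr.
set g := repr _.
have /cotorsion_classE[h <-] : cotorsion_class g = cotorsion_class f.
  exact: reprK.
exact: precomp_iota_scale.
Qed.

Fact cotorsion_scaleA r s z :
  cotorsion_scale r (cotorsion_scale s z) = cotorsion_scale (r * s) z.
Proof.
by have [f <-] := cotorsion_class_surj z; rewrite !cotorsion_scaleE scalerA.
Qed.
Fact cotorsion_scale1 : left_id 1 cotorsion_scale.
Proof.
move=> z; have [f <-] := cotorsion_class_surj z.
by rewrite cotorsion_scaleE scale1r.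
Qed.
Fact cotorsion_scaleDr : right_distributive cotorsion_scale +%R.
Proof.
move=> r z1 z2; have [f <-] := cotorsion_class_surj z1.
have [g <-] := cotorsion_class_surj z2.
by rewrite -raddfD !cotorsion_scaleE scalerDr raddfD.
Qed.
Fact cotorsion_scaleDl z : {morph cotorsion_scale^~ z : r s / r + s}.
Proof.
move=> r s; have [f <-] := cotorsion_class_surj z.
by rewrite !cotorsion_scaleE scalerDl raddfD.
Qed.
HB.instance Definition _ := GRing.Zmodule_isLmodule.Build R cotorsion_mod
  cotorsion_scaleA cotorsion_scale1 cotorsion_scaleDr cotorsion_scaleDl.

Definition cotorsion_proj (x : C) : cotorsion_mod :=
  cotorsion_class (hom_of_elt x).
Fact cotorsion_proj_is_linear : linear cotorsion_proj.
Proof.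
move=> k x y.
by rewrite /cotorsion_proj hom_of_elt_is_linear raddfD /= -cotorsion_scaleE.
Qed.
HB.instance Definition _ := GRing.isLinear.Build R C cotorsion_mod *:%R
  cotorsion_proj cotorsion_proj_is_linear.

Lemma cotorsion_proj1 (f : {linear R^o -> C}) :
  cotorsion_proj (f 1) = cotorsion_class f.
Proof. by rewrite /cotorsion_proj hom_of_elt1. Qed.

Lemma cotorsion_proj_surj z : exists x, cotorsion_proj x = z.
Proof.
have [f <-] := cotorsion_class_surj z.
by exists ((f : {linear R^o -> C}) 1); exact: cotorsion_proj1.
Qed.

End Object.

Section Map.
Variables (C D : lmodType R) (f : {linear C -> D}).

Definition postcomp (g : HomMod R^o C) : HomMod R^o D :=
  (f \o (g : {linear R^o -> C}) : {linear R^o -> D}).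

Definition cotorsion_map (z : cotorsion_mod C) : cotorsion_mod D :=
  cotorsion_class (postcomp (repr (z : Quotient.quot _))).

Lemma cotorsion_mapE g :
  cotorsion_map (cotorsion_class g) = cotorsion_class (postcomp g).
Proof.
apply/cotorsion_classE; set g' := repr _.
have /cotorsion_classE[h hE] : cotorsion_class g' = cotorsion_class g.
  exact: reprK.
exists (f \o (h : {linear E -> C}) : {linear E -> D}).
apply: hom_ext => a.
have /= hEa := congr1 (fun k : HomMod R^o C => (k : {linear R^o -> C}) a) hE.
by rewrite /= hEa linearB.
Qed.

Fact cotorsion_map_is_linear : linear cotorsion_map.
Proof.
move=> k z1 z2; have [g1 <-] := cotorsion_class_surj z1.
have [g2 <-] := cotorsion_class_surj z2.
have -> : k *: cotorsion_class g1 + cotorsion_class g2 =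
          cotorsion_class (k *: g1 + g2) by rewrite raddfD /= -cotorsion_scaleE.
rewrite !cotorsion_mapE.
have -> : postcomp (k *: g1 + g2) = k *: postcomp g1 + postcomp g2.
  by apply: hom_ext => a; exact: linearD.
by rewrite raddfD /= -cotorsion_scaleE.
Qed.
HB.instance Definition _ := GRing.isLinear.Build R
  (cotorsion_mod C) (cotorsion_mod D) *:%R cotorsion_map
  cotorsion_map_is_linear.

Lemma cotorsion_proj_natural x :
  cotorsion_map (cotorsion_proj x) = cotorsion_proj (f x).
Proof.
rewrite /cotorsion_proj cotorsion_mapE; congr cotorsion_class.
by apply: hom_ext => a; exact: linearZ.
Qed.

End Map.

Lemma cotorsion_map_id (C : lmodType R) (z : cotorsion_mod C) :
  cotorsion_map (idfun : {linear C -> C}) z = z.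
Proof.
by have [x <-] := cotorsion_proj_surj z; rewrite cotorsion_proj_natural.
Qed.

Lemma cotorsion_map_comp (C D F : lmodType R) (g : {linear D -> F})
    (f : {linear C -> D}) (z : cotorsion_mod C) :
  cotorsion_map (g \o f : {linear C -> F}) z =
  cotorsion_map g (cotorsion_map f z).
Proof.
by have [x <-] := cotorsion_proj_surj z; rewrite !cotorsion_proj_natural.
Qed.

Definition cotorsion : quotient_functor R :=
  {| qf_obj := cotorsion_mod : lmodType R -> lmodType R;
     qf_map := fun C D f => cotorsion_map f : {linear _ -> _};
     qf_proj := fun C => @cotorsion_proj C : {linear _ -> _};
     qf_map_id := cotorsion_map_id;
     qf_map_comp := cotorsion_map_comp;
     qf_proj_surj := cotorsion_proj_surj;
     qf_proj_natural := cotorsion_proj_natural |}.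

End Cotorsion.

(* Main.v *)
(* A map h : I -> C already takes its values in q^-1(C): for e in I the map
   R -> I, 1 |-> e, extends along iota to an endomorphism k of I, as I is
   injective, and h \o k sends iota 1 to h e.  So h corestricts to
   I -> q^-1(C). *)
Require Import Defs.
From HB Require Import structures.
From mathcomp Require Import all_boot all_algebra all_classical.

Set Implicit Arguments.
Unset Strict Implicit.
Unset Printing Implicit Defensive.

Import GRing.Theory.
Local Open Scope ring_scope.

Section Corestriction.
Variables (R : pzRingType) (L M N : lmodType R).
Variables (f : {linear M -> N}) (h : {linear L -> M}).
Hypothesis fh0 : forall x, f (h x) = 0.

Definition corestrict (x : L) : ker_mod f :=
  KerMod (introT (ker_predP f (h x)) (fh0 x)).

Fact corestrict_is_linear : linear corestrict.
Proof. by move=> k x y; apply: val_inj; rewrite /= linearP. Qed.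
HB.instance Definition _ :=
  GRing.isLinear.Build R L (ker_mod f) *:%R corestrict corestrict_is_linear.

End Corestriction.

(** Under the isomorphism of Hom(R, C) with C, evaluation at 1, precomposition with iota becomes
    evaluation at iota 1. *)
Lemma cotorsion_proj_eq0 (R : pzRingType) (E : injective_envelope R^o)
    (C : lmodType R) (x : C) :
  cotorsion_proj E x = 0 <->
  exists h : {linear E -> C}, h (env_map E 1) = x.
Proof.
have -> : 0 = cotorsion_class E (0 : HomMod R^o C) by rewrite raddf0.
rewrite cotorsion_classE subr0; split=> -[h hx]; exists h.
  have /= -> := congr1 (fun g : HomMod R^o C => (g : {linear R^o -> C}) 1) hx.
  exact: hom_of_eltK.
(* A linear map on [R^o] is determined by its value at 1. *)
by rewrite -[LHS]hom_of_elt1 /= hx.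
Qed.

Lemma cotorsion_proj_hom (R : pzRingType) (E : injective_envelope R^o)
    (C : lmodType R) (h : {linear E -> C}) (e : E) :
  cotorsion_proj E (h e) = 0.
Proof.
have [k kE] := env_injective (env_map_inj (i := E))
  (hom_of_elt e : {linear R^o -> E}).
apply/cotorsion_proj_eq0; exists (h \o k : {linear E -> C}) => /=.
by rewrite kE hom_of_eltK.
Qed.

Theorem proposition3p15 (R : pzRingType) (E : injective_envelope R^o) :
  coradical (cotorsion E).
Proof.
move=> C z; have [x <-] := qf_proj_surj z.
(* Since [x] lies in the kernel q^-1(C), its value in C is h (iota 1) for some [h] from the envelope
   to C. *)
have /cotorsion_proj_eq0[h hx] : cotorsion_proj E (val x) = 0.
  exact/ker_predP/(valP x).
apply/cotorsion_proj_eq0.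
(* The corestriction of [h] to q^-1(C) sends iota 1 to [x] itself, so the class of [x] in q(q^-1(C))
   vanishes. *)
exists (corestrict (f := qf_proj (cotorsion E) C) (cotorsion_proj_hom h)).
exact: val_inj.
Qed.
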